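(* Let $\alpha>0$ be a constant and let $s,t\in\mathbb{N}$ with $2\le s\le t$. Then there exist a sufficiently large constant $K=K(\alpha,t)>0$, depending only on $\alpha$ and $t$, and a constant $\beta>0$, depending only on $\alpha,s,t$, such that the following holds. Let $G$ be a $K_{s,t}$-free graph on $n$ vertices satisfying $|E(G)|\ge\alpha n^{2-\frac1s}$. Then for any $p\in[0,1]$ with $p\ge\frac{K}{n^{1-1/s}}$, with high probability $G_p$ contains a cycle of length at least $\beta n$, i.e. the probability that $G_p$ contains such a cycle tends to $1$ as $n\to\infty$, uniformly over all such $G$ and $p$.
   Context: Graphs are finite and simple. $K_{s,t}$ is the complete bipartite graph with parts of sizes $s$ and $t$; a graph is $K_{s,t}$-free if it contains no copy of $K_{s,t}$ as a (not necessarily induced) subgraph. For $p\in[0,1]$, $G_p$ denotes the random subgraph of $G$ on vertex set $V(G)$ obtained by retaining each edge of $G$ independently with probability $p$. ''With high probability'' means with probability tending to $1$ as $n\to\infty$, with $\alpha,s,t$ fixed. *)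

(* Defs.v *)
From HB Require Import structures.
From mathcomp Require Import all_boot all_order all_algebra.
From mathcomp Require Import boolp reals.
Set Implicit Arguments.
Unset Strict Implicit.
Unset Printing Implicit Defensive.
Import Order.TTheory GRing.Theory Num.Theory.

Local Open Scope ring_scope.

Record sgraph (V : finType) := SGraph {
  adj :> rel V;
  adj_sym : symmetric adj;
  adj_irrefl : irreflexive adj }.

(* Edges are unordered pairs, so that #|edges G| is the usual |E(G)|. *)
Definition edges (V : finType) (G : sgraph V) : {set {set V}} :=
  [set [set x; y] | x in V, y in V & G x y].

(* Not necessarily induced: non-edges of H may be sent to edges of G. *)
Definition contains_copy (U V : finType) (H : sgraph U) (G : sgraph V) : Prop :=
  exists2 f : U -> V, injective f & forall x y, H x y -> G (f x) (f y).

Section CompleteBipartite.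
Variables s t : nat.

Definition Kst_adj : rel ('I_s + 'I_t)%type := fun x y =>
  match x, y with
  | inl _, inr _ | inr _, inl _ => true
  | _, _ => false
  end.

Fact Kst_sym : symmetric Kst_adj. Proof. by move=> [] ? []. Qed.
Fact Kst_irrefl : irreflexive Kst_adj. Proof. by case. Qed.

Definition complete_bipartite := SGraph Kst_sym Kst_irrefl.
End CompleteBipartite.

Definition Kst_free (s t : nat) (V : finType) (G : sgraph V) : Prop :=
  ~ contains_copy (complete_bipartite s t) G.

Section Subgraph.
Variables (V : finType) (G : sgraph V) (F : {set {set V}}).

Definition restrict_adj : rel V := fun x y => G x y && ([set x; y] \in F).

Fact restrict_sym : symmetric restrict_adj.
Proof. by move=> x y; rewrite /restrict_adj adj_sym setUC. Qed.

Fact restrict_irrefl : irreflexive restrict_adj.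
Proof. by move=> x; rewrite /restrict_adj adj_irrefl. Qed.

Definition restrict := SGraph restrict_sym restrict_irrefl.
End Subgraph.

(* The probability that G_p satisfies P. The set F of retained edges ranges
   over the subsets of the edge set; by independence, F has probability the
   product over all edges of p (retained) or 1 - p (deleted). *)
Definition Pr_Gp (R : realType) (V : finType) (G : sgraph V) (p : R)
    (P : sgraph V -> Prop) : R :=
  \sum_(F : {set {set V}} | (F \subset edges G) && `[< P (restrict G F) >])
    \prod_(e in edges G) (if e \in F then p else 1 - p).

(* The bound 3 <= size c excludes single edges traversed back and forth,
   which satisfy ucycle G. *)
Definition has_cycle_ge (R : realType) (V : finType) (l : R) (G : sgraph V) :
    Prop :=
  exists c : seq V, [/\ ucycle G c, (3 <= size c)%N & l <= (size c)%:R].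

(* Main.v *)
Require Import Defs.
From HB Require Import structures.
From mathcomp Require Import all_boot all_order all_algebra.
From mathcomp Require Import boolp reals sequences exp.
From mathcomp Require Import ring lra.
Set Implicit Arguments.
Unset Strict Implicit.
Unset Printing Implicit Defensive.
Import Order.TTheory GRing.Theory Num.Theory.
Local Open Scope ring_scope.

(** A K_{s,t}-free graph is locally sparse: a set of w vertices spans
    O(w^(2-1/s)) edges ([kst_bound]). So a fraction x = w/n of the vertices
    spans a fraction O(x^(2-1/s)) of the at least alpha n^(2-1/s) edges, which
    is much smaller than x when x is small. The random subgraph inherits
    this down to the level of individual sets: with high probability it keeps
    at least c n edges, for a c proportional to p n^(1-1/s), while every set of
    w <= delta n vertices spans fewer than (c/3) w retained edges. The first
    claim is a Chernoff bound. For the second, a given set of w vertices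
    fails with probability at most (w/n)^(3w) once p n^(1-1/s) is at least
    144/alpha ([tail_exponent]); this beats the number of sets of size w, which
    is at most (e n/w)^w, and the sum over all w is O(1/n) ([union_term]).
    Both bounds come from the moment generating function [mgf_le].

    A graph that is dense globally and sparse on small sets has a long cycle,
    deterministically. A minimal vertex set U of density at least c has
    the property that every S in U with at most delta n / 3 elements has more
    than 2 |S| neighbours in U outside S ([dense_cycle]); and in an expanding
    set the rotation technique of Posa, applied to a longest path, gives a
    cycle with more than delta n / 3 vertices ([posa_cycle]). *)

(** * Long cycles in expanding vertex sets *)

Lemma rev_sorted_sym (V : finType) (G : sgraph V) (l : seq V) :
  sorted G (rev l) = sorted G l.
Proof. by rewrite rev_sorted; apply: eq_sorted => x y; rewrite adj_sym. Qed.

(** A path is a list whose head is the moving end and whose last vertex stays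
    fixed, so that a rotation at a neighbour [y] of the head reverses the
    prefix that precedes [y]. *)
Inductive rotation (V : finType) (G : sgraph V) (l0 : seq V) : seq V -> Prop :=
| rotation_refl : rotation G l0 l0
| rotation_step x l1 y l2 : rotation G l0 ((x :: l1) ++ y :: l2) -> G x y ->
    rotation G l0 (rev (x :: l1) ++ y :: l2).

Definition path_nbr (T : eqType) (l : seq T) (u v : T) :=
  infix [:: u; v] l || infix [:: v; u] l.

(** The seam of a concatenation contributes exactly one consecutive pair. *)
Lemma infix2_cat (T : eqType) (u v : T) (l1 l2 : seq T) (z y : T) :
  infix [:: u; v] (rcons l1 z ++ y :: l2) =
  [|| infix [:: u; v] (rcons l1 z), (u == z) && (v == y)
    | infix [:: u; v] (y :: l2)].
Proof.
elim: l1 => [|a l1 IH].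
  by rewrite cat_cons infix_consl /= prefix0s !andbT andbF.
rewrite !rcons_cons !cat_cons infix_consl IH (infix_consl _ a) -!orbA.
congr orb; case: l1 {IH} => [|b l] /=; by rewrite ?prefix0s.
Qed.

Lemma path_nbr_sym (T : eqType) (l : seq T) u v :
  path_nbr l u v = path_nbr l v u.
Proof. by rewrite /path_nbr orbC. Qed.

(** A rotation drops the pair formed by [y] and its predecessor [last x l1] and
    creates the pair [x], [y]; reversing the prefix keeps all other pairs. *)
Lemma path_nbr_rotate (T : eqType) (x y u v : T) (l1 l2 : seq T) :
  u != x -> u != y -> u != last x l1 ->
  path_nbr (rev (x :: l1) ++ y :: l2) u v = path_nbr ((x :: l1) ++ y :: l2) u v.
Proof.
move=> ux uy uz.
have E : rev (x :: l1) = rcons (rev l1) x by rewrite rev_cons.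
rewrite /path_nbr {1 2}E {1 2}(lastI x l1) !infix2_cat -E -lastI.
rewrite (negbTE ux) (negbTE uy) (negbTE uz) !andbF !andFb !orFb.
have R a b : infix [:: a; b] (rev (x :: l1)) = infix [:: b; a] (x :: l1).
  by rewrite -[RHS]infix_rev.
by rewrite !R; do !case: (infix _ _).
Qed.

(** Positions in a duplicate-free list give two functions whose images contain
    all path-neighbours; this is how a set [R] is seen to have at most
    [2 * #|R|] of them. *)
Lemma path_nbr_nth (T : eqType) (l : seq T) (u v : T) : uniq l ->
  path_nbr l u v ->
  v = nth u l (index u l).+1 \/ v = nth u l (index u l).-1.
Proof.
move=> Ul /orP[] /infixP[l1 [l2 El]]; move: Ul; rewrite El cat_uniq.
  move=> /and3P[_ /hasPn N _]; left.
  have nu : u \notin l1 by apply: N; rewrite mem_head.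
  by rewrite index_cat (negbTE nu) /= eqxx addn0 nth_cat ltnNge leqnSn /= subSnn.
move=> /and3P[_ /hasPn N /andP[vn _]]; right.
have nu : u \notin l1 by apply: N; rewrite !inE eqxx orbT.
have vu : (v == u) = false.
  by apply/negbTE; apply: contra vn => /eqP ->; rewrite mem_head.
by rewrite index_cat (negbTE nu) /= vu eqxx addn1 /= nth_cat ltnn subnn.
Qed.

Definition ext_nbrs (V : finType) (G : sgraph V) (U S : {set V}) : {set V} :=
  [set y in U :\: S | [exists x in S, G x y]].

Section Posa.
Variables (V : finType) (G : sgraph V) (U : {set V}) (k : nat).
Hypothesis U_n0 : U != set0.
Hypothesis k_gt0 : (0 < k)%N.
Hypothesis expands : forall S : {set V}, S \subset U ->
  (0 < #|S| <= k)%N -> (2 * #|S| < #|ext_nbrs G U S|)%N.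

Let upath l := [&& sorted G l, uniq l & all (mem U) l].

Let upath_rotate x l1 y l2 : G x y ->
  upath ((x :: l1) ++ y :: l2) -> upath (rev (x :: l1) ++ y :: l2).
Proof.
move=> xy /and3P[so un al]; apply/and3P; split.
- move: so; rewrite /= cat_path /= => /and3P[so _ so2].
  have : sorted G (rev (x :: l1)) by rewrite rev_sorted_sym.
  have E : rev (x :: l1) = rcons (rev l1) x by rewrite rev_cons.
  rewrite E; case: (rev l1) => [|b l] /=; first by rewrite xy.
  by rewrite cat_path last_rcons => -> /=; rewrite xy.
- by rewrite (@perm_uniq _ _ ((x :: l1) ++ y :: l2)) // perm_cat2r perm_rev.
- by move: al; rewrite !all_cat all_rev.
Qed.

(** Rotations of a longest path. If the head of a path is adjacent to one of its
    vertices [y], the path is [A ++ y :: B] where [A] and [y] form a cycle.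
    Among the longest paths of [U] choose such a splitting with [A] as long as
    possible. Then no rotation, however often repeated, can use a pivot in [B],
    so the tail [y :: B] never changes and all the heads [R] that arise lie in
    [A]. By maximality the neighbours of [R] lie on the path. A vertex outside
    [R] that has no path-neighbour in [R] keeps its path-neighbours through
    all rotations, hence can never be a pivot; so every outer neighbour of [R]
    is a path-neighbour of [R] in the initial path, and there are at most
    [2 * #|R|] of these. Expansion forces [k < #|R|], and [R] is contained in
    the cycle through [A] and [y], which has [size A + 1] vertices. *)
Lemma posa_cycle : exists2 c : seq V, ucycle G c & (k.+2 <= size c)%N.
Proof.
have [x0 x0U] := set0Pn _ U_n0.
have bound l : upath l -> (size l <= #|V|)%N.
  by move=> /and3P[_ un _]; rewrite -(card_uniqP un) max_card.
have [L [l [pl szl]] maxL] : exists2 L, exists l, upath l /\ size l = L &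
    forall l, upath l -> (size l <= L)%N.
  have ex : exists L, `[< exists l, upath l /\ size l = L >].
    by exists 1%N; apply/asboolP; exists [:: x0]; rewrite /upath /= x0U.
  have ub L : `[< exists l, upath l /\ size l = L >] -> (L <= #|V|)%N.
    by move=> /asboolP[l [pl <-]]; apply: bound.
  case: (ex_maxnP ex ub) => L /asboolP LP Lm; exists L => // l pl.
  by apply: Lm; apply/asboolP; exists l.
have head_nbr x l' y : upath (x :: l') -> size (x :: l') = L -> y \in U ->
    G x y -> y \in l'.
  move=> pl' sz yU xy; case yl : (y \in x :: l').
    move: yl; rewrite inE => /orP[/eqP yx|//].
    by move: xy; rewrite yx adj_irrefl.
  suff : upath (y :: x :: l') by move=> /maxL; rewrite -sz /= ltnn.
  move: pl' => /and3P[so un al].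
  by apply/and3P; split; rewrite /= ?yl //= ?yU // adj_sym xy.
pose closes A y B := [/\ upath (A ++ y :: B), size (A ++ y :: B) = L &
  exists x l', A = x :: l' /\ G x y].
have [m [A [y [B [clA szA]]]] maxm] :
    exists2 m, exists A y B, closes A y B /\ size A = m &
    forall A y B, closes A y B -> (size A <= m)%N.
  have ex : exists m, `[< exists A y B, closes A y B /\ size A = m >].
    case: l pl szl => [|x l'] pl szl.
      by have /maxL : upath [:: x0] by [rewrite /upath /= x0U]; rewrite -szl.
    have xU : x \in U by case/and3P: pl => _ _ /andP[].
    have yN : (0 < #|ext_nbrs G U [set x]|)%N.
      apply: leq_ltn_trans (expands _ _); first exact: leq0n.
      - by rewrite sub1set.
      - by rewrite cards1.
    have [y] := card_gt0P yN.
    rewrite !inE => /andP[/andP[_ yU] /existsP[x' /andP[]]].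
    rewrite inE => /eqP -> xy.
    have /splitPr E := head_nbr x l' y pl szl yU xy.
    case: E pl szl => A B pl szl; exists (size (x :: A)); apply/asboolP.
    by exists (x :: A), y, B; split => //; split => //; exists x, A.
  have ub m : `[< exists A y B, closes A y B /\ size A = m >] -> (m <= #|V|)%N.
    move=> /asboolP[A [y [B [[/bound pA _ _] <-]]]].
    by apply: leq_trans pA; rewrite size_cat leq_addr.
  case: (ex_maxnP ex ub) => m /asboolP mP mm; exists m => // A y B cl.
  by apply: mm; apply/asboolP; exists A, y, B.
case: (clA) => pQ0 szQ0 [a [A' [EA ay]]].
set Q0 := A ++ y :: B in pQ0 szQ0.
have reach Q : rotation G Q0 Q -> [/\ upath Q, perm_eq Q Q0 &
    exists2 A1, Q = A1 ++ y :: B & size A1 = m].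
  elim=> {Q} [|x l1 z l2 _ [pQ permQ [A1 EQ szA1]] xz].
    by split=> //; exists A.
  (* The pivot closes a cycle through the whole prefix before it, so this
     prefix is no longer than [A1], and [y :: B] survives the rotation. *)
  have cl : closes (x :: l1) z l2.
    by split=> //; [rewrite (perm_size permQ) | exists x, l1].
  have le1 : (size (x :: l1) <= size A1)%N by rewrite szA1; apply: maxm cl.
  split; first exact: upath_rotate.
    by apply: perm_trans permQ; rewrite perm_cat2r perm_rev.
  exists (rev (x :: l1) ++ drop (size (x :: l1)) A1).
    rewrite -catA; congr (_ ++ _).
    have := congr1 (drop (size (x :: l1))) EQ.
    rewrite drop_size_cat // drop_cat => ->; move: le1.
    rewrite leq_eqVlt => /orP[/eqP ->|->] //.
    by rewrite ltnn subnn drop_size.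
  by rewrite size_cat size_rev size_drop subnKC.
pose R := [set x | `[< exists l, rotation G Q0 (x :: l) >]].
have RP x l1 : rotation G Q0 (x :: l1) -> x \in R.
  by move=> rx; rewrite inE; apply/asboolP; exists l1.
have RA : {subset R <= A}.
  move=> x; rewrite inE => /asboolP[l1 rx].
  have [/and3P[_ un _] permQ [[|x1 A1] EQ szA1]] := reach _ rx.
    by move: szA1; rewrite -szA EA.
  case: EQ => Ex El; subst x1.
  have : x \in Q0 by rewrite -(perm_mem permQ) mem_head.
  rewrite mem_cat => /orP[//|xB]; move: un.
  by rewrite El /= mem_cat xB orbT.
have RU : R \subset U.
  apply/subsetP => x /RA xA; case/and3P: pQ0 => _ _ /allP; apply.
  by rewrite mem_cat xA.
have R_gt0 : (0 < #|R|)%N.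
  apply/card_gt0P; exists a; apply: (RP _ (A' ++ y :: B)).
  by rewrite -cat_cons -EA; apply: rotation_refl.
(* A rotation turns the predecessor of its pivot into the new head. *)
have pivot x l1 z l2 : rotation G Q0 ((x :: l1) ++ z :: l2) -> G x z ->
    last x l1 \in R.
  move=> rQ xz; have := rotation_step rQ xz.
  by rewrite lastI rev_rcons => /RP.
have frozen u : u \notin R -> (forall r, r \in R -> ~~ path_nbr Q0 u r) ->
    forall Q, rotation G Q0 Q -> path_nbr Q u =1 path_nbr Q0 u.
  move=> uR nR Q; elim=> {Q} [//|x l1 z l2 rQ IH xz v].
  have zR := pivot _ _ _ _ rQ xz.
  rewrite path_nbr_rotate //.
  - by apply: contra uR => /eqP ->; apply: RP rQ.
  (* Were [u] the pivot, its predecessor, which is in [R], would be one of its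
     path-neighbours already, hence one in the initial path by induction. *)
  - apply/eqP => uz; have := nR _ zR.
    rewrite -IH uz /path_nbr (lastI x l1) !infix2_cat !eqxx.
    by rewrite !orbT.
  - by apply: contra uR => /eqP ->.
have NR : (#|ext_nbrs G U R| <= 2 * #|R|)%N.
  have sub : ext_nbrs G U R \subset
      [set nth u Q0 (index u Q0).+1 | u in R] :|:
      [set nth u Q0 (index u Q0).-1 | u in R].
    apply/subsetP => u; rewrite in_set in_setD in_setU.
    move=> /andP[/andP[uR uU] /existsP[x /andP[xR xu]]].
    have [r rR rn] : exists2 r, r \in R & path_nbr Q0 u r.
      apply: contrapT => nex.
      move: (xR); rewrite inE => /asboolP[l1 rx].
      have [pQ permQ _] := reach _ rx.
      have szQ : size (x :: l1) = L by rewrite (perm_size permQ).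
      have /splitPr E := head_nbr _ _ _ pQ szQ uU xu.
      case: E rx {pQ permQ szQ} => p1 p2 rx.
      have zR := pivot _ _ _ _ rx xu.
      have : path_nbr (x :: p1 ++ u :: p2) u (last x p1).
        by rewrite -cat_cons (lastI x p1) /path_nbr !infix2_cat !eqxx !orbT.
      rewrite (frozen u uR) //; last first.
        by move=> r rR; apply/negP => rn; apply: nex; exists r.
      by move=> rn; apply: nex; exists (last x p1).
    case/and3P: pQ0 => _ unQ _.
    rewrite path_nbr_sym in rn.
    have [E|E] := path_nbr_nth unQ rn; apply/orP; [left|right];
      by apply/imsetP; exists r.
  apply: leq_trans (subset_leq_card sub) _.
  apply: leq_trans (leq_card_setU _ _) _.
  by rewrite mul2n -addnn leq_add // leq_imset_card.
have kR : (k < #|R|)%N.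
  rewrite ltnNge; apply/negP => Rk.
  have := expands RU; rewrite R_gt0 Rk => /(_ isT).
  by rewrite ltnNge NR.
have kA : (k < size A)%N.
  apply: leq_trans kR _; apply: leq_trans (card_size A).
  by apply: subset_leq_card; apply/subsetP.
exists (rcons A y); last by rewrite size_rcons.
case/and3P: pQ0 => so un _; rewrite /Q0 -cat_rcons in so un.
apply/andP; split; last by move: un; rewrite cat_uniq => /andP[].
move: so; rewrite EA /= cat_path => /andP[so _].
by rewrite rcons_path so last_rcons adj_sym.
Qed.
End Posa.

(** * From density to expansion *)

Definition edges_in (V : finType) (G : sgraph V) (W : {set V}) : {set {set V}} :=
  [set e in edges G | e \subset W].

Lemma edgesP (V : finType) (G : sgraph V) (e : {set V}) :
  reflect (exists x y, G x y /\ e = [set x; y]) (e \in edges G).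
Proof.
apply: (iffP imset2P) => [[x y _]|[x [y [xy ->]]]].
  by rewrite inE => /andP[_ xy] ->; exists x, y.
by exists x y; rewrite // inE.
Qed.

(** Splits the edges inside [U] according to whether they meet [S]. *)
Lemma edges_in_split (V : finType) (G : sgraph V) (U S : {set V}) :
  S \subset U ->
  (#|edges_in G U| <= #|edges_in G (U :\: S)| +
     #|edges_in G (S :|: ext_nbrs G U S)|)%N.
Proof.
move=> SU; apply: leq_trans (leq_card_setU _ _).
apply: subset_leq_card; apply/subsetP => e.
rewrite !inE => /andP[eG]; rewrite eG /=; case/edgesP: eG => x [y [xy ->]].
rewrite !subUset !sub1set => /andP[xU yU].
rewrite !inE xU yU !andbT /=.
have [xS|xS] := boolP (x \in S); have [yS|yS] := boolP (y \in S) => //=.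
- by apply/existsP; exists x; rewrite xS xy.
- by rewrite andbT; apply/existsP; exists y; rewrite yS adj_sym xy.
Qed.

(** A minimal nonempty set [U] that spans at least [c * #|U|] edges expands:
    removing [S] from [U] leaves a density below [c], so at least [c * #|S|] edges
    of [U] meet [S], and all of them lie in [S] together with its outer
    neighbours. If there were only [2 * #|S|] such neighbours, that set of
    at most [3 * #|S|] vertices would be too dense. *)
Lemma dense_cycle (R : realType) (V : finType) (G : sgraph V) (c : R) (k : nat) :
  0 < c -> (0 < k)%N -> (0 < #|V|)%N -> c * #|V|%:R <= #|edges G|%:R ->
  (forall W : {set V}, (0 < #|W| <= 3 * k)%N ->
     #|edges_in G W|%:R < c / 3%:R * #|W|%:R) ->
  exists2 l : seq V, ucycle G l & (k.+2 <= size l)%N.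
Proof.
move=> c0 k0 V0 cV sparse.
pose dense U := (U != set0) && (c * #|U|%:R <= #|edges_in G U|%:R).
have edges0 : #|edges_in G set0| = 0%N.
  apply/eqP; rewrite cards_eq0; apply/eqP/setP => e; rewrite !inE subset0.
  apply/negbTE/andP => -[/edgesP[x [y [_ ->]]] /eqP /setP /(_ x)].
  by rewrite !inE eqxx.
have denseT : dense setT.
  rewrite /dense -card_gt0 cardsT V0; apply: le_trans cV _.
  rewrite ler_nat; apply: subset_leq_card; apply/subsetP => e eG.
  by rewrite inE eG subsetT.
have [U /minsetP[/andP[U0 dU] minU]] :=
  ex_minset (ex_intro (fun U => is_true (dense U)) _ denseT).
apply: (posa_cycle U0 k0) => S SU /andP[S0 Sk].
have cS : c * #|S|%:R <= #|edges_in G (S :|: ext_nbrs G U S)|%:R.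
  have /(congr1 (fun m => m%:R : R)) := cardsID S U.
  rewrite (setIidPr SU) natrD => cardU.
  have le1 : #|edges_in G (U :\: S)|%:R <= c * #|U :\: S|%:R.
    have [->|n0] := eqVneq (U :\: S) set0.
      by rewrite edges0 mulr_ge0 // ltW.
    rewrite leNgt; apply/negP => /ltW le1.
    have /setP E : U :\: S = U by apply: minU (subsetDl _ _); apply/andP.
    have [x xS] := card_gt0P S0.
    by have := E x; rewrite inE xS (subsetP SU).
  have := edges_in_split G SU; rewrite -(ler_nat R) natrD => le2.
  move: dU; rewrite -cardU mulrDr => le3.
  rewrite -(lerD2r (c * #|U :\: S|%:R)); apply: le_trans le3 _.
  by apply: le_trans le2 _; rewrite addrC lerD2l.
rewrite ltnNge; apply/negP => small.
set W := S :|: ext_nbrs G U S in cS.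
have W3 : (#|W| <= 3 * #|S|)%N.
  apply: leq_trans (leq_card_setU _ _) _.
  by rewrite (mulnDl 1 2) mul1n leq_add2l.
have W0 : (0 < #|W|)%N by apply: leq_trans S0 (subset_leq_card (subsetUl _ _)).
have := sparse W; rewrite W0 (leq_trans W3) ?leq_mul2l //.
move=> /(_ isT); rewrite ltNge => /negP; apply.
apply: le_trans cS; rewrite -mulrA ler_pM2l // mulrC ler_pdivrMr ?ltr0n //.
by rewrite -natrM ler_nat mulnC.
Qed.

(** * Edges inside a set of vertices of a graph without K_{s,t} *)

Lemma codegree_lt (V : finType) (G : sgraph V) (s t : nat) (f : 'I_s -> V) :
  Kst_free s t G -> injective f ->
  (#|[set v | [forall i, G v (f i)]]| < t)%N.
Proof.
move=> free injf; rewrite ltnNge; apply/negP => tle; apply: free.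
set A := [set v | _] in tle.
pose g (j : 'I_t) : V := enum_val (widen_ord tle j).
have gA j i : G (g j) (f i).
  by have := enum_valP (widen_ord tle j); rewrite inE => /forallP.
have fg i j : f i = g j -> False.
  by move=> E; have := gA j i; rewrite E adj_irrefl.
exists (fun x => match x with inl i => f i | inr j => g j end).
  move=> [i|j] [i'|j'] //=; first by move=> /injf ->.
  - by move=> /fg.
  - by move=> /esym /fg.
  - by move=> /enum_val_inj E; congr inr; apply: val_inj; case: E.
by move=> [i|j] [i'|j'] //= _; rewrite // adj_sym.
Qed.

Definition deg_in (V : finType) (G : sgraph V) (W : {set V}) (v : V) :=
  #|[set y in W | G v y]|.

(** Double counting of the pairs made of a vertex of [W] and an injective
    sequence of [s] neighbours of it in [W]: such a sequence has fewer than [t]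
    common neighbours. *)
Lemma star_count (V : finType) (G : sgraph V) (s t : nat) (W : {set V}) :
  Kst_free s t G ->
  (\sum_(v in W) deg_in G W v ^_ s <= t * #|W| ^ s)%N.
Proof.
move=> free.
pose I := [set f : {ffun 'I_s -> V} in ffun_on (mem W) | injectiveb f].
have E v : deg_in G W v ^_ s = (\sum_(f in I | [forall i, G v (f i)]) 1)%N.
  rewrite /deg_in -{1}(card_ord s) -card_inj_ffuns_on sum1_card.
  apply: eq_card => f; rewrite !inE unfold_in /= !inE.
  rewrite andbAC; congr (_ && _).
  apply/forallP/andP => [H|[/forallP H1 /forallP H2] i].
    by split; apply/forallP => i; have := H i; rewrite inE => /andP[].
  by rewrite inE H1 H2.
under eq_bigr => v _ do rewrite E.
rewrite (exchange_big_dep (fun f => f \in I)) /=; last by move=> ? ? _ /andP[].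
apply: (@leq_trans (\sum_(f in I) t)).
  apply: leq_sum => f; rewrite inE => /andP[_ /injectiveP injf].
  rewrite sum1_card; apply: leq_trans (ltnW (codegree_lt free injf)).
  apply: subset_leq_card; apply/subsetP => v.
  by rewrite unfold_in inE => /and3P[].
rewrite sum_nat_const mulnC leq_mul2l; apply/orP; right.
rewrite card_inj_ffuns_on card_ord ffact_prod -[X in (_ <= _ ^ X)%N](card_ord s).
rewrite -prod_nat_const; apply: leq_prod => i _; exact: leq_subr.
Qed.

Lemma leq_exp_ffact n m : ((n - m) ^ m <= n ^_ m)%N.
Proof.
rewrite ffact_prod -[X in (_ ^ X <= _)%N](card_ord m) -prod_nat_const.
by apply: leq_prod => i _; rewrite leq_sub2l // ltnW.
Qed.

(** An edge is the image of an ordered pair of adjacent vertices. *)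
Lemma edges_in_deg (V : finType) (G : sgraph V) (W : {set V}) :
  (#|edges_in G W| <= \sum_(v in W) deg_in G W v)%N.
Proof.
have -> : (\sum_(v in W) deg_in G W v)%N =
    #|[set z : V * V | (z.1 \in W) && ((z.2 \in W) && G z.1 z.2)]|.
  rewrite -sum1_card; under [in RHS]eq_bigl => z do rewrite inE.
  rewrite -(pair_big_dep (mem W) (fun x y => (y \in W) && G x y) (fun _ _ => 1%N)).
  apply: eq_bigr => v _; rewrite sum1_card.
  by apply: eq_card => y; rewrite inE.
apply: leq_trans (leq_imset_card (fun z => [set z.1; z.2]) _).
apply: subset_leq_card; apply/subsetP => e.
rewrite inE => /andP[/edgesP[x [y [xy ->]]]].
rewrite subUset !sub1set => /andP[xW yW]; apply/imsetP; exists (x, y) => //.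
by rewrite inE /= xW yW.
Qed.

(** The bound of Kovari, Sos and Turan, with [q] standing for the real power
    of exponent [1 - 1 / s] of [#|W|]. Convexity is replaced by truncation: a
    degree excess [a] over [s] is at most [q], or else at most [a ^+ s] divided
    by [q ^+ s.-1]; the sum of the latter terms is controlled by
    [star_count]. *)
Lemma kst_bound (R : realType) (V : finType) (G : sgraph V) (s t : nat)
    (W : {set V}) (q : R) :
  (0 < s)%N -> Kst_free s t G -> 1 <= q -> q ^+ s = #|W|%:R ^+ s.-1 ->
  #|edges_in G W|%:R <= (1 + s + t)%:R * (#|W|%:R * q).
Proof.
case: s => // s _ free q1 /= qs; set w := #|W|.
have q0 : 0 < q by apply: lt_le_trans q1.
have cut (a : nat) : a%:R <= q + a%:R ^+ s.+1 / q ^+ s :> R.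
  have [aq|qa] := lerP a%:R q.
    by apply: le_trans aq _; rewrite lerDl divr_ge0 // exprn_ge0 // ltW.
  apply: ler_wpDl; first exact: ltW.
  rewrite exprS -mulrA ler_peMr // ler_pdivlMr ?exprn_gt0 // mul1r.
  by apply: lerXn2r; rewrite ?nnegrE ?ler0n // ltW.
have degle v : (deg_in G W v)%:R <= s.+1%:R + q +
    (deg_in G W v ^_ s.+1)%:R / q ^+ s :> R.
  set d := deg_in G W v.
  have le1 : (d <= s.+1 + (d - s.+1))%N by rewrite -leq_subLR.
  have := cut (d - s.+1)%N; rewrite -natrX => le2.
  have le3 : ((d - s.+1) ^ s.+1)%:R / q ^+ s <= (d ^_ s.+1)%:R / q ^+ s :> R.
    by rewrite ler_pM2r ?invr_gt0 ?exprn_gt0 // ler_nat leq_exp_ffact.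
  move: le1; rewrite -(ler_nat R) natrD => le1.
  apply: le_trans le1 _; rewrite -addrA lerD2l.
  by apply: le_trans le2 _; rewrite lerD2l.
have := edges_in_deg G W; rewrite -(ler_nat R) => le.
apply: le_trans le _; rewrite natr_sum.
apply: (@le_trans _ _ (\sum_(v in W) (s.+1%:R + q +
    (deg_in G W v ^_ s.+1)%:R / q ^+ s))); first exact: ler_sum.
rewrite big_split /= sumr_const -mulr_suml -natr_sum.
have st : (\sum_(v in W) deg_in G W v ^_ s.+1)%:R / q ^+ s <= t%:R * (w%:R * q) :> R.
  rewrite ler_pdivrMr ?exprn_gt0 // -!mulrA -exprS qs -exprS -natrX -natrM ler_nat.
  exact: star_count.
have sw : (s.+1%:R + q) *+ w <= (1 + s.+1)%:R * (w%:R * q).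
  rewrite -mulr_natl natrD [leRHS]mulrDl mul1r mulrDr [leLHS]addrC lerD2l.
  rewrite mulrCA ler_wpM2l //; first by rewrite ler_peMr.
by rewrite natrD [leRHS]mulrDl lerD.
Qed.

(** * Exponential moments of the retained edges *)

Lemma sum_subset_prod (R : comNzRingType) (T : finType) (E : {set T})
    (f g : T -> R) :
  \sum_(F : {set T} | F \subset E) \prod_(e in E) (if e \in F then f e else g e)
  = \prod_(e in E) (f e + g e).
Proof.
pose f' e := if e \in E then f e else 0.
pose g' e := if e \in E then g e else 1.
transitivity (\prod_e (f' e + g' e)); last first.
  rewrite [RHS]big_mkcond /=; apply: eq_bigr => e _.
  by rewrite /f' /g'; case: ifP => // _; rewrite add0r.
rewrite bigA_distr [LHS]big_mkcond; apply: eq_bigr => F _ /=.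
case: ifPn => [/subsetP FE|/subsetPn[e eF eE]].
  rewrite big_mkcond; apply: eq_bigr => e _ /=; rewrite /f' /g'.
  by have [eE //|/negP eE] := boolP (e \in E); case: ifP => // /FE.
by rewrite (bigD1 e) //= eF /f' (negbTE eE) mul0r.
Qed.

(** The number of retained edges in [A] is binomial with parameters [#|A|] and
    [p], so its moment generating function is [1 + p * (expR theta - 1)] to the
    power [#|A|]; then use the inequality [1 + x <= expR x]. *)
Lemma mgf_le (R : realType) (T : finType) (E A : {set T}) (p theta : R) :
  0 <= p <= 1 -> A \subset E ->
  \sum_(F : {set T} | F \subset E)
     (\prod_(e in E) (if e \in F then p else 1 - p)) * expR (theta * #|F :&: A|%:R)
  <= expR (p * (expR theta - 1) * #|A|%:R).
Proof.
move=> /andP[p0 p1] AE.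
pose f e : R := p * (if e \in A then expR theta else 1).
have -> : \sum_(F : {set T} | F \subset E)
     (\prod_(e in E) (if e \in F then p else 1 - p)) * expR (theta * #|F :&: A|%:R)
   = \prod_(e in E) (f e + (1 - p)).
  rewrite -sum_subset_prod; apply: eq_bigr => F FE.
  have -> : expR (theta * #|F :&: A|%:R) =
      \prod_(e in E) (if (e \in F) && (e \in A) then expR theta else 1).
    rewrite mulrC expRM_natl -big_mkcondr /= -prodr_const; apply: eq_bigl => e.
    rewrite inE; apply/idP/idP => [/andP[eF eA]|/andP[]//].
    by rewrite eF eA (subsetP AE).
  rewrite -big_split; apply: eq_bigr => e _ /=; rewrite /f.
  by case: (e \in F) => //=; rewrite mulr1.
rewrite mulrC expRM_natl -prodr_const.
rewrite [leRHS](big_setID E) [leLHS](big_setID A) /=.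
have -> : A :&: E = A by apply/setIidPl.
have -> : E :&: A = A by apply/setIidPr.
have -> : A :\: E = set0 by apply/eqP; rewrite setD_eq0.
rewrite big_set0 mulr1 [X in _ * X]big1 ?mulr1; last first.
  by move=> e; rewrite !inE /f => /andP[/negbTE -> _]; rewrite mulr1 addrC subrK.
apply: ler_prod => e eA; rewrite /f eA; apply/andP; split.
  by rewrite addr_ge0 ?subr_ge0 // mulr_ge0 // expR_ge0.
by apply: le_trans (expR_ge1Dx _); lra.
Qed.

Lemma weight_ge0 (R : realType) (T : finType) (E F : {set T}) (p : R) :
  0 <= p <= 1 -> 0 <= \prod_(e in E) (if e \in F then p else 1 - p).
Proof.
by move=> /andP[p0 p1]; apply: prodr_ge0 => e _; case: ifP; rewrite ?subr_ge0.
Qed.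

(** Markov's inequality: the expectation of a nonnegative function that is at
    least 1 on the bad outcomes bounds the probability of failure. *)
Lemma Pr_Gp_fail (R : realType) (V : finType) (G : sgraph V) (p : R)
    (P : sgraph V -> Prop) (Phi : {set {set V}} -> R) :
  0 <= p <= 1 -> (forall F, 0 <= Phi F) ->
  (forall F : {set {set V}},
     F \subset edges G -> ~ P (restrict G F) -> 1 <= Phi F) ->
  `|Pr_Gp G p P - 1| <=
  \sum_(F : {set {set V}} | F \subset edges G)
     (\prod_(e in edges G) (if e \in F then p else 1 - p)) * Phi F.
Proof.
move=> p01 Phi0 PhiP.
have tot : \sum_(F : {set {set V}} | F \subset edges G)
     (\prod_(e in edges G) (if e \in F then p else 1 - p)) = 1.
  rewrite sum_subset_prod big1 // => e _; by rewrite addrC subrK.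
rewrite distrC -{1}tot (bigID (fun F => `[< P (restrict G F) >])) /=.
rewrite [X in X - _]addrC addrK ger0_norm; last first.
  by apply: sumr_ge0 => F _; exact: weight_ge0.
rewrite [leRHS](bigID (fun F => `[< P (restrict G F) >])) /=.
apply: ler_wpDl.
  by apply: sumr_ge0 => F _; rewrite mulr_ge0 // weight_ge0.
apply: ler_sum => F /andP[FE /asboolPn nP].
by rewrite ler_peMr ?weight_ge0 // PhiP.
Qed.

Lemma edges_restrict (V : finType) (G : sgraph V) (F : {set {set V}}) :
  F \subset edges G -> edges (restrict G F) = F.
Proof.
move=> /subsetP FE; apply/setP => e; apply/edgesP/idP.
  by move=> [x [y [/andP[_ eF] ->]]].
move=> eF; have /edgesP[x [y [xy E]]] := FE _ eF.
by exists x, y; split => //=; rewrite /restrict_adj xy -E.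
Qed.

Lemma edges_in_restrict (V : finType) (G : sgraph V) (F : {set {set V}}) W :
  F \subset edges G -> edges_in (restrict G F) W = F :&: edges_in G W.
Proof.
move=> FE; apply/setP => e; rewrite !inE edges_restrict //.
by case: (boolP (e \in F)) => // /(subsetP FE) ->.
Qed.

(** * Summing over all small sets *)

Lemma sum_by_card (R : realType) (V : finType) (m : nat) (f : nat -> R) :
  \sum_(W : {set V} | (0 < #|W| <= m)%N) f #|W| =
  \sum_(j < #|V|.+1 | (0 < j <= m)%N) f j *+ 'C(#|V|, j).
Proof.
have inK (W : {set V}) : (inord #|W| : 'I_#|V|.+1) = #|W| :> nat.
  by rewrite inordK // ltnS max_card.
rewrite (partition_big (fun W : {set V} => inord #|W| : 'I_#|V|.+1)
  (fun j : 'I_#|V|.+1 => (0 < j <= m)%N)) => [|W]; last by rewrite inK.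
apply: eq_bigr => j jm; rewrite -card_draws -sumr_const.
apply: eq_big => [W|W /andP[_ /eqP <-]]; last by rewrite inK.
rewrite inE; apply/andP/eqP => [[_ /eqP <-]|E]; first by rewrite inK.
by rewrite E jm; split=> //; apply/eqP/val_inj; rewrite /= -E inK.
Qed.

Lemma sum_half_le1 (R : realType) (N : nat) (Q : pred nat) :
  \sum_(j < N | Q j && (0 < j)%N) 2%:R^-1 ^+ j <= 1 :> R.
Proof.
case: N => [|N]; first by rewrite big_ord0.
have E : \sum_(j < N.+1) (if (0 < j)%N then 2%:R^-1 ^+ j else 0) =
    1 - 2%:R^-1 ^+ N :> R.
  elim: N => [|N IH]; first by rewrite big_ord_recl big_ord0 /= expr0 addr0 subrr.
  by rewrite big_ord_recr IH /= exprS; field.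
apply: (@le_trans _ _ (1 - 2%:R^-1 ^+ N)); last first.
  by rewrite gerBl exprn_ge0 // invr_ge0.
rewrite -E big_mkcond; apply: ler_sum => j _.
by case: (Q j) => //=; case: ifP => // _; rewrite exprn_ge0 // invr_ge0.
Qed.

(** With [x = w / n], the binomial theorem bounds ['C(n, w) * x ^+ w] by
    [(1 + x) ^+ n], hence by [expR w]. Here [L] is the logarithm of
    [n / w]. *)
Lemma bin_le_expR (R : realType) (n w : nat) (L : R) : (w <= n)%N ->
  n%:R * expR (- L) = w%:R -> 'C(n, w)%:R <= expR (w%:R * (1 + L)) :> R.
Proof.
move=> wn nL; set x := expR (- L) in nL.
have x0 : 0 < x by exact: expR_gt0.
have le1 : x ^+ w *+ 'C(n, w) <= (1 + x) ^+ n.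
  have wn1 : (w < n.+1)%N by [].
  rewrite exprDn (bigD1 (Ordinal wn1)) //= expr1n mul1r lerDl.
  by apply: sumr_ge0 => i _; rewrite mulrn_wge0 // expr1n mul1r exprn_ge0 // ltW.
have le2 : (1 + x) ^+ n <= expR w%:R.
  rewrite -nL expRM_natl lerXn2r // ?nnegrE ?expR_ge0 ?expR_ge1Dx //.
  by rewrite addr_ge0 // ltW.
rewrite mulrDr mulr1 expRD -[X in _ * expR X]opprK -mulrN expRN expRM_natl.
by rewrite ler_pdivlMr ?exprn_gt0 // mulr_natl (le_trans le1).
Qed.

(** If each set of [w] vertices is bad with probability at most
    [(w / n) ^+ (3 * w)], then one factor [(w / n) ^+ w] pays for the number of
    these sets and the other two leave a geometric series divided by [n]. *)
Lemma union_term (R : realType) (n w : nat) (L : R) : (0 < w <= n)%N ->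
  n%:R * expR (- L) = w%:R -> 3%:R <= L ->
  expR (- (3%:R * w%:R * L)) *+ 'C(n, w) <= n%:R^-1 * 2%:R^-1 ^+ w.
Proof.
move=> /andP[w0 wn] nL L3.
have n0 : (0 < n%:R :> R) by rewrite ltr0n (leq_trans w0).
have w1 : 1 <= w%:R :> R by rewrite ler1n.
have e2 : 2%:R <= expR 1 :> R by apply: le_trans (expR_ge1Dx 1); rewrite -natr1.
rewrite -[leLHS]mulr_natr.
apply: (@le_trans _ _ (expR (- (3%:R * w%:R * L)) * expR (w%:R * (1 + L)))).
  by rewrite ler_wpM2l ?expR_ge0 // bin_le_expR.
rewrite -expRD; apply: (@le_trans _ _ (expR (- L) * expR (- (2%:R * w%:R)))).
  (* What is left of the exponent is [w - 2 w L], and [w >= 1] and [L >= 3]. *)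
  rewrite -expRD ler_expR; nra.
have -> : expR (- L) = n%:R^-1 * w%:R by rewrite -nL mulKf // gt_eqF.
rewrite -mulrA ler_pM2l ?invr_gt0 // expRN ler_pdivrMr ?expR_gt0 //.
have -> : expR (2%:R * w%:R) = expR 1 ^+ w * expR 1 ^+ w :> R.
  by rewrite -!expRM_natl mulr1 -expRD; congr expR; ring.
rewrite mulrA -exprMn.
apply: (@le_trans _ _ (expR 1 ^+ w)); last first.
  by rewrite ler_peMl ?exprn_ge0 ?expR_ge0 // exprn_ege1 // mulrC ler_pdivlMr ?mul1r.
rewrite -expRM_natl mulr1; apply: le_trans (expR_ge1Dx _); lra.
Qed.

(** * Long cycles in the random subgraph *)

(** The Chernoff exponent for a set [W] of [w] vertices spanning [a] edges, with
    [qw], [qn] the real powers of exponent [1 - 1 / s] of [w] and [n], and with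
    [L = ln (n / w)]. The choice [expR theta = qn / qw] turns the mean term
    into [p * C * w * qn], the same order as the threshold; as [theta >= L / 2],
    the lower bound on [L] makes the threshold term twice as large as the
    mean, and the lower bound on [p * qn] turns half of the threshold term into
    [3 * w * L]. *)
Lemma tail_exponent (R : realType) (alpha p a C w qw qn theta L : R) :
  0 < alpha -> 0 <= p -> 0 <= a -> 0 <= w -> 0 <= L ->
  a <= C * (w * qw) -> expR theta * qw = qn -> L / 2%:R <= theta ->
  48%:R * C / alpha <= L -> 144%:R / alpha <= p * qn ->
  p * (expR theta - 1) * a - theta * (p * alpha * qn * w / 12%:R) <=
  - (3%:R * w * L).
Proof.
move=> al0 p0 a0 w0 L0 aC thq thL CL pq.
have step1 : p * (expR theta - 1) * a <= p * (C * (w * qn)).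
  rewrite -mulrA ler_wpM2l // -thq.
  apply: (@le_trans _ _ (expR theta * a)).
    by rewrite ler_wpM2r // gerBl.
  apply: le_trans (_ : expR theta * (C * (w * qw)) <= _).
    by rewrite ler_wpM2l // expR_ge0.
  by rewrite le_eqVlt; apply/orP; left; apply/eqP; ring.
have CL' : C <= L * alpha / 48%:R.
  by move: CL; rewrite ler_pdivrMr //; lra.
have pq' : 144%:R <= p * qn * alpha by rewrite -ler_pdivrMr.
set X := p * qn in pq pq'.
have X0 : 0 <= X by apply: le_trans pq; rewrite divr_ge0 // ltW.
have Xw : 0 <= X * w by rewrite mulr_ge0.
have step2 : X * w * (C - theta * alpha / 12%:R) <= X * w * (- (L * alpha / 48%:R)).
  rewrite ler_wpM2l //.
  have : L / 2%:R * alpha <= theta * alpha by rewrite ler_pM2r.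
  lra.
have step3 : 144%:R * (w * L) <= X * alpha * (w * L).
  by rewrite ler_wpM2r // mulr_ge0.
have E : p * (C * (w * qn)) - theta * (p * alpha * qn * w / 12%:R) =
  X * w * (C - theta * alpha / 12%:R) by rewrite /X; ring.
lra.
Qed.

(** Failure is charged to two kinds of events, with
    [c = p * alpha * q / 4]: at most [p * #|edges G| / 4] edges are
    retained (this number is at least [c * #|V|]), or some nonempty set [W] of
    at most [delta * #|V|] vertices spans at least [c / 3 * #|W|] retained edges. As [c]
    scales with [p], the estimates are uniform in [p]. Each of the two kinds
    contributes at most [1 / #|V|] to the expectation of
    [Phi]. *)
Lemma Pr_long_cycle (R : realType) (alpha p : R) (s t : nat) (V : finType)
    (G : sgraph V) (delta := expR (- (48%:R * (1 + s + t)%:R / alpha + 3%:R)) : R)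
    (q := #|V|%:R `^ (1 - s%:R^-1) : R) :
  0 < alpha -> (2 <= s)%N -> Kst_free s t G ->
  alpha * (#|V|%:R * q) <= #|edges G|%:R -> 0 <= p <= 1 ->
  144%:R / alpha <= p * q -> 1 <= delta / 3%:R * #|V|%:R ->
  `|Pr_Gp G p (has_cycle_ge (delta / 3%:R * #|V|%:R)) - 1| <= 2%:R / #|V|%:R.
Proof.
move=> al0 s2 free aE p01 pq big; set n := #|V|.
have /andP[p0 p1] := p01.
have d0 : 0 < delta by exact: expR_gt0.
have n0 : 0 < n%:R :> R.
  rewrite ltNge; apply/negP => n0; move: big; rewrite leNgt => /negP; apply.
  apply: (@le_lt_trans _ _ 0) => //.
  by apply: mulr_ge0_le0 => //; rewrite divr_ge0 // ltW.
have s0 : 0 < s%:R :> R by rewrite ltr0n (leq_trans _ s2).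
set r : R := 1 - s%:R^-1 in q pq aE *.
have r2 : 2%:R^-1 <= r.
  have : s%:R^-1 <= 2%:R^-1 :> R by rewrite lef_pV2 ?posrE // ler_nat.
  by rewrite /r; lra.
have rs : r * s%:R = s.-1%:R.
  by rewrite /r mulrBl mul1r mulVf ?gt_eqF // -subn1 natrB // (leq_trans _ s2).
have C0 : 0 <= 48%:R * (1 + s + t)%:R / alpha :> R.
  by rewrite divr_ge0 ?mulr_ge0 // ltW.
pose k := Num.trunc (delta / 3%:R * n%:R).
have kn : k%:R <= delta / 3%:R * n%:R.
  by rewrite /k truncn_le (le_trans _ big).
have k0 : (0 < k)%N by rewrite truncn_gt0.
pose L (w : nat) : R := ln (n%:R / w%:R).
pose theta w := r * L w.
(* [thr w] is [c / 3 * w] for the density [c] described above. *)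
pose thr w := p * alpha * q * w%:R / 12%:R.
(* [delta] is chosen for the last bound, which serves both [tail_exponent] and
   [union_term]. *)
have Lw w : (0 < w <= 3 * k)%N -> [/\ (w <= n)%N, n%:R * expR (- L w) = w%:R &
    48%:R * (1 + s + t)%:R / alpha + 3%:R <= L w].
  move=> /andP[w0 wk].
  have w0' : 0 < w%:R :> R by rewrite ltr0n.
  have nw : 0 < n%:R / w%:R :> R by rewrite divr_gt0.
  have wd : w%:R <= delta * n%:R.
    have : w%:R <= 3%:R * k%:R :> R by rewrite -natrM ler_nat.
    by move: kn; lra.
  have EL : n%:R * expR (- L w) = w%:R.
    rewrite expRN lnK // invf_div mulrCA mulfV ?mulr1 //; by rewrite gt_eqF.
  split=> //.
    rewrite -(ler_nat R); apply: le_trans wd _.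
    rewrite ler_piMl //.
    rewrite /delta expRN invf_le1 ?expR_gt0 //.
    by apply: le_trans (expR_ge1Dx _); lra.
  rewrite -lerN2 -ler_expR -/delta -(ler_pM2l n0) EL mulrC; exact: wd.
pose A W := edges_in G W.
pose Phi (F : {set {set V}}) : R :=
  expR (-1 * #|F :&: edges G|%:R) * expR (p * #|edges G|%:R / 4%:R) +
  \sum_(W : {set V} | (0 < #|W| <= 3 * k)%N)
    expR (theta #|W| * #|F :&: A W|%:R) * expR (- (theta #|W| * thr #|W|)).
have Phi0 F : 0 <= Phi F.
  by rewrite addr_ge0 ?mulr_ge0 ?expR_ge0 // sumr_ge0 // => W _;
    rewrite mulr_ge0 ?expR_ge0.
have PhiP (F : {set {set V}}) : F \subset edges G ->
    ~ has_cycle_ge (delta / 3%:R * n%:R) (restrict G F) -> 1 <= Phi F.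
  move=> FE ncyc; rewrite leNgt; apply/negP => lt1; apply: ncyc.
  have sum_lt : \sum_(W : {set V} | (0 < #|W| <= 3 * k)%N)
      expR (theta #|W| * #|F :&: A W|%:R) * expR (- (theta #|W| * thr #|W|)) < 1.
    by apply: le_lt_trans lt1; rewrite /Phi lerDr mulr_ge0 ?expR_ge0.
  have many : p * #|edges G|%:R / 4%:R < #|F|%:R.
    have : expR (-1 * #|F :&: edges G|%:R) * expR (p * #|edges G|%:R / 4%:R) < 1.
      apply: le_lt_trans lt1; rewrite /Phi lerDl sumr_ge0 // => W _.
      by rewrite mulr_ge0 ?expR_ge0.
    by rewrite (setIidPl FE) -expRD -[ltRHS]expR0 ltr_expR; lra.
  have q0 : 0 < p * q by apply: lt_le_trans pq; rewrite divr_gt0.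
  have [l cyc lk] : exists2 l, ucycle (restrict G F) l & (k.+2 <= size l)%N.
    apply: (@dense_cycle R V (restrict G F) (p * alpha * q / 4%:R) k) => //.
    - by rewrite divr_gt0 // mulrAC mulr_gt0.
    - by rewrite -(ltr0n R).
    - rewrite edges_restrict //; apply: le_trans (ltW many).
      have : p * (alpha * (n%:R * q)) <= p * #|edges G|%:R by rewrite ler_wpM2l.
      by rewrite -/n; lra.
    move=> W Ws; rewrite edges_in_restrict // ltNge; apply/negP => dense.
    have [_ _ LW] := Lw _ Ws.
    have th0 : 0 <= theta #|W| by rewrite /theta mulr_ge0 //; lra.
    move: sum_lt; rewrite (bigD1 W) //= ltNge => /negP; apply.
    apply: ler_wpDr.
      by rewrite sumr_ge0 // => W' _; rewrite mulr_ge0 ?expR_ge0.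
    rewrite -expRD -[leLHS]expR0 ler_expR -mulrBr mulr_ge0 // subr_ge0 /thr.
    by apply: le_trans dense; lra.
  exists l; split=> //; first exact: leq_trans lk.
  apply: ltW; apply: lt_le_trans (truncnS_gt _) _.
  by rewrite -/k ler_nat ltnW.
apply: le_trans (Pr_Gp_fail p01 Phi0 PhiP) _.
under eq_bigr => F _ do rewrite /Phi mulrDr mulr_sumr.
rewrite big_split /= (mulrDl 1 1) mul1r; apply: lerD.
  under eq_bigr => F _ do rewrite mulrA.
  rewrite -mulr_suml.
  apply: (@le_trans _ _ (expR (p * (expR (-1) - 1) * #|edges G|%:R) *
     expR (p * #|edges G|%:R / 4%:R))).
    by rewrite ler_wpM2r ?expR_ge0 // mgf_le.
  (* The exponent [p M (expR (-1) - 1) + p M / 4], where [M] counts the edges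
     of [G], is at most [- p M / 4], and [p M >= 144 n]. *)
  have e2 : expR (-1) <= 2%:R^-1 :> R.
    rewrite expRN lef_pV2 ?posrE ?expR_gt0 //.
    by apply: le_trans (expR_ge1Dx 1); rewrite -natr1.
  have pM : 144%:R * n%:R <= p * #|edges G|%:R.
    apply: (@le_trans _ _ (p * (alpha * (n%:R * q)))); last by rewrite ler_wpM2l.
    have : 144%:R * n%:R <= p * q * alpha * n%:R.
      by rewrite ler_pM2r // -ler_pdivrMr.
    by lra.
  have pE : p * (expR (-1) - 1) * #|edges G|%:R <= p * #|edges G|%:R * - 2%:R^-1.
    rewrite mulrAC ler_wpM2l ?mulr_ge0 //; lra.
  rewrite -expRD; apply: (@le_trans _ _ (expR (- n%:R))).
    rewrite ler_expR; lra.
  rewrite expRN lef_pV2 ?posrE ?expR_gt0 //.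
  by apply: le_trans (expR_ge1Dx _); rewrite lerDr.
rewrite exchange_big /=.
apply: (@le_trans _ _ (\sum_(W : {set V} | (0 < #|W| <= 3 * k)%N)
    expR (- (3%:R * #|W|%:R * L #|W|)))).
  apply: ler_sum => W Ws; have [wn EL LW] := Lw _ Ws.
  under eq_bigr => F _ do rewrite mulrA.
  rewrite -mulr_suml.
  have AE : A W \subset edges G by apply/subsetP => e; rewrite inE => /andP[].
  apply: le_trans (ler_wpM2r (expR_ge0 _) (mgf_le _ p01 AE)) _.
  rewrite -expRD ler_expR.
  have w0 : (0 < #|W|)%N by case/andP: Ws.
  have w0' : 0 < #|W|%:R :> R by rewrite ltr0n.
  have L0 : 0 <= L #|W| by lra.
  apply: (@tail_exponent _ alpha p _ (1 + s + t)%:R _ (#|W|%:R `^ r)) => //.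
  - apply: kst_bound => //; first by rewrite (leq_trans _ s2).
      apply: (@le_trans _ _ (1 `^ r)); first by rewrite powR1.
      rewrite ge0_ler_powR ?nnegrE ?ler1n //.
      by apply: le_trans r2; rewrite invr_ge0.
    by rewrite -powR_mulrn ?powR_ge0 // -powRrM rs powR_mulrn.
  - rewrite /theta /q -/n -/r /powR !gt_eqF // -expRD -mulrDr; congr (expR (r * _)).
    by rewrite /L lnM ?posrE ?invr_gt0 // lnV ?posrE // subrK.
  - rewrite /theta; move: (ler_wpM2r L0 r2); lra.
  - lra.
rewrite (sum_by_card V _ (fun w => expR (- (3%:R * w%:R * L w)))).
apply: (@le_trans _ _ (\sum_(j < n.+1 | (j <= 3 * k)%N && (0 < j)%N)
    n%:R^-1 * 2%:R^-1 ^+ j)).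
  rewrite [leRHS](eq_bigl (fun j : 'I_n.+1 => (0 < j <= 3 * k)%N)); last first.
    by move=> j; rewrite andbC.
  apply: ler_sum => j js; have [jn EL LW] := Lw _ js.
  apply: union_term => //; first by case/andP: js => -> _.
  by lra.
rewrite -mulr_sumr ler_piMr ?invr_ge0 //.
exact: (@sum_half_le1 R n.+1 (fun j => j <= 3 * k)%N).
Qed.

Theorem corollary4 (R : realType) (alpha : R) (t : nat) (alpha_gt0 : 0 < alpha) :
  exists2 K : R, 0 < K &
  forall s : nat, (2 <= s <= t)%N ->
  exists2 beta : R, 0 < beta &
  forall eps : R, 0 < eps ->
  exists N : nat,
  forall (n : nat) (V : finType) (G : sgraph V) (p : R),
    (N <= n)%N ->
    #|V| = n ->
    Kst_free s t G ->
    alpha * n%:R `^ (2 - s%:R^-1) <= #|edges G|%:R ->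
    0 <= p <= 1 ->
    K / n%:R `^ (1 - s%:R^-1) <= p ->
    `|Pr_Gp G p (has_cycle_ge (beta * n%:R)) - 1| < eps.
Proof.
exists (144%:R / alpha) => [|s /andP[s2 _]]; first by rewrite divr_gt0.
set delta : R := expR (- (48%:R * (1 + s + t)%:R / alpha + 3%:R)).
have d0 : 0 < delta by exact: expR_gt0.
exists (delta / 3%:R) => [|eps eps0]; first by rewrite divr_gt0.
exists (maxn (Num.trunc (3%:R / delta)).+1 (Num.trunc (2%:R / eps)).+1).
move=> n V G p; rewrite geq_max => /andP[n1 n2] Vn; subst n.
have {}n1 : 3%:R / delta < #|V|%:R.
  by apply: lt_le_trans (truncnS_gt _) _; rewrite ler_nat.
have {}n2 : 2%:R / eps < #|V|%:R.
  by apply: lt_le_trans (truncnS_gt _) _; rewrite ler_nat.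
have n0 : 0 < #|V|%:R :> R by apply: lt_trans n1; rewrite divr_gt0.
move=> free aE p01 pK.
apply: le_lt_trans (_ : 2%:R / #|V|%:R < eps); last first.
  by rewrite ltr_pdivrMr // mulrC -ltr_pdivrMr.
apply: (@Pr_long_cycle R alpha p s t V G) => //.
- have -> : #|V|%:R * #|V|%:R `^ (1 - s%:R^-1) = #|V|%:R `^ (2 - s%:R^-1) :> R.
    rewrite -[X in X * _]powRr1 ?ltW // -powRD ?(gt_eqF n0) ?implybT //.
    by congr (_ `^ _); ring.
  exact: aE.
- by move: pK; rewrite ler_pdivrMr // powR_gt0.
- by move/ltW: n1; rewrite ler_pdivrMr // -/delta => n1; lra.
Qed.
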